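(* Let $m,m_0$ be nonnegative integers with $m+m_0>0$ and let $G$ be a $(2m+2m_0)$-edge-connected graph. Then $G$ has an $m$-tree-connected factor $H$ such that $G\setminus E(H)$ is $m_0$-tree-connected and for each vertex $v$, $$\left\lfloor\frac{d_G(v)}{2}\right\rfloor-m_0\le d_{H}(v)\le \left\lceil\frac{d_G(v)}{2}\right\rceil+m.$$ Furthermore, for an arbitrary given vertex $z$ and any integer $t$ with $\lfloor d_G(z)/2\rfloor-m_0\le t\le \lceil d_G(z)/2\rceil+m$, $H$ can be chosen so that additionally $d_H(z)=t$.
   Context: Graphs may have loops and multiple edges. A factor is a spanning subgraph. A graph is $m$-tree-connected if it contains $m$ edge-disjoint spanning trees.
   Formalization: The ''furthermore'' part is stated for graphs with at least two vertices; for a one-vertex graph (vacuously edge-connected) it fails, since d_H(z) is always even while the range of t contains an odd integer. *)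

(* Defs.v *)
From mathcomp Require Import all_boot all_order all_algebra.

Set Implicit Arguments.
Unset Strict Implicit.
Unset Printing Implicit Defensive.

(* Finite graphs with loops and multiple edges. The order of the two components
   of [endpoints e] carries no meaning; [e] is a loop when they are equal. *)
Record mgraph := MGraph {
  vertex : finType;
  edge : finType;
  endpoints : edge -> vertex * vertex
}.

Section Defs.
Variable G : mgraph.
Implicit Types (F H T : {set edge G}) (x y v : vertex G).

Definition joins (e : edge G) x y : bool :=
  (endpoints e == (x, y)) || (endpoints e == (y, x)).

(* A factor (spanning subgraph) of G is identified with its edge set F, so that
   [setT] is G itself and [~: F] is G minus the edges of F. *)

(* Both ends are counted: a loop contributes 2 to the degree of its vertex. *)
Definition degree F v : nat :=
  \sum_(e in F) (((endpoints e).1 == v) + ((endpoints e).2 == v)).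

Definition adjacent F : rel (vertex G) :=
  fun x y => [exists e in F, joins e x y].

Definition connected F : Prop := forall x y, connect (adjacent F) x y.

(* [p] lists, for each step of the walk, the edge used and the vertex reached. *)
Fixpoint walk F x (p : seq (edge G * vertex G)) y : bool :=
  if p is (e, x') :: p' then [&& e \in F, joins e x x' & walk F x' p' y]
  else x == y.

(* A loop is a cycle of length 1, a pair of parallel edges one of length 2;
   distinctness of the edges excludes going back and forth along one edge. *)
Definition is_cycle F x (p : seq (edge G * vertex G)) : Prop :=
  [/\ p <> [::], walk F x p x, uniq [seq s.1 | s <- p]
    & uniq [seq s.2 | s <- p]].

Definition acyclic F : Prop := forall x p, ~ is_cycle F x p.

Definition spanning_tree T : Prop := connected T /\ acyclic T.

Definition tree_connected (m : nat) F : Prop :=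
  exists T : 'I_m -> {set edge G},
    [/\ forall i, T i \subset F,
        forall i, spanning_tree (T i)
      & forall i j, i != j -> [disjoint T i & T j]].

End Defs.

(* A graph with a single vertex is k-edge-connected for every k; where prescribed
   degrees are at stake (only even degrees occur on one vertex), such graphs have
   to be excluded explicitly. *)
Definition edge_connected (k : nat) (G : mgraph) : Prop :=
  forall X : {set edge G}, #|X| < k -> connected (~: X).

Import GRing.Theory Num.Theory.
Local Open Scope ring_scope.

(* The bounds are compared in [int], so that the subtraction is not truncated. *)
Definition half_degree_range (G : mgraph) (m m0 : nat) (v : vertex G) (t : int)
    : Prop :=
  (((degree setT v)./2)%:Z - m0%:Z <= t) /\
  (t <= (uphalf (degree setT v))%:Z + m%:Z).

Definition good_factor (G : mgraph) (m m0 : nat) (H : {set edge G}) : Prop :=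
  [/\ tree_connected m H, tree_connected m0 (~: H)
    & forall v : vertex G, half_degree_range m m0 v (degree H v)%:Z].

(* Main.v *)
Require Import Defs.
From mathcomp Require Import all_boot all_order all_algebra zify.

(** Put [k = m + m0]. Loops can be shared out at the end, because the allowed
    range of degrees has length at least [k > 0]; so let [G] be loopless. By
    uncrossing tight sets, the half-degrees [d(v) / 2] can be rounded to the
    indegrees of an orientation in which every nonempty set avoiding [z] is
    entered by at least [k] arcs, and in which [z] has outdegree
    [floor (d(z) / 2)]. By Edmonds' theorem this orientation contains [k]
    disjoint arborescences rooted at [z]: reserve [m] of them for [H] and [m0]
    for the complement. If [a(v)] and [b(v)] are the outdegrees of [v] in these
    two families, the remaining arcs have to be 2-coloured with at most
    [ceil (d(v) / 2) - a(v)] arcs of the first colour and at most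
    [ceil (d(v) / 2) - b(v)] of the second one at [v] (at [z], with [t - a(z)]
    and [d(z) - t - b(z)]). Both bounds are at least the remaining outdegree of
    [v], which is a Hall-type condition for this colouring; parity causes no
    obstruction because at [v <> z] the two bounds add up to more than the
    remaining degree. *)

Set Implicit Arguments.
Unset Strict Implicit.
Unset Printing Implicit Defensive.

(** * Sums over finite sets *)

Lemma sum_setT (V : finType) (f : V -> nat) :
  \sum_(v in [set: V]) f v = \sum_v f v.
Proof. by apply: eq_bigl => v; rewrite inE. Qed.

Lemma sum_setUI (V : finType) (f : V -> nat) (X Y : {set V}) :
  \sum_(v in X) f v + \sum_(v in Y) f v =
  \sum_(v in X :&: Y) f v + \sum_(v in X :|: Y) f v.
Proof.
rewrite ![\sum_(v in _) _]big_mkcond -!big_split /=; apply: eq_bigr => v _.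
by rewrite !inE; case: (v \in X); case: (v \in Y) => //=; rewrite addnC.
Qed.

Lemma sum_subsetD (V : finType) (f : V -> nat) (X W : {set V}) :
  X \subset W ->
  \sum_(v in W) f v = \sum_(v in X) f v + \sum_(v in W :\: X) f v.
Proof. by move=> XW; rewrite (big_setID X) /= (setIidPr XW). Qed.

(** * Rounding half-degrees under an intersecting supermodular demand *)

Section HalfRounding.
Variables (V : finType) (d : V -> nat) (p : {set V} -> nat) (z : V).
Hypothesis p_supermodular : forall X Y, X :&: Y != set0 ->
  p X + p Y <= p (X :&: Y) + p (X :|: Y).
Hypothesis p_le : forall X, 2 * p X <= \sum_(v in X) d v.

Let lowered (D : {set V}) v := uphalf (d v) - (v \in D).

(** Rounding everything up meets the demand [p]. Now round down at a maximal set [D] of odd vertices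
    other than [z]. Each odd vertex still rounded up lies in a tight set, and a tight set satisfies
    [2 * f(X) = 2 * p X <= d(X)], so only [z] can contribute an excess, of one unit. *)
Lemma half_rounding : exists f : V -> nat,
  [/\ forall v, (d v)./2 <= f v <= uphalf (d v), f z = uphalf (d z),
      forall X, p X <= \sum_(v in X) f v
    & 2 * \sum_v f v <= (\sum_v d v).+1].
Proof.
pose ok (D : {set V}) := (D \subset [set v | odd (d v) & v != z]) &&
  [forall X : {set V}, p X <= \sum_(v in X) lowered D v].
have ok0 : ok set0.
  rewrite /ok sub0set /=; apply/forallP => X.
  rewrite -(leq_pmul2l (isT : 0 < 2)); apply: leq_trans (p_le X) _.
  rewrite big_distrr /=; apply: leq_sum => v _.
  by rewrite /lowered inE; lia.
have [D /maxsetP[/andP[/subsetP Dsub /forallP Dok] Dmax]] := ex_maxset (ex_intro (fun D => ok D) _ ok0).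
pose f := lowered D.
have fodd v : v \in D -> odd (d v) by move/Dsub; rewrite inE => /andP[].
exists f; split=> [v||X|].
- by rewrite /f /lowered; case Dv: (v \in D); [have := fodd v Dv|]; lia.
- by rewrite /f /lowered; case Dz: (z \in D); [move/Dsub: Dz; rewrite inE eqxx andbF|lia].
- exact: Dok.
(* By maximality of [D], lowering [v] violates some set; it must contain [v] and have been tight
   before. *)
have tight_bad v : odd (d v) -> v != z -> v \notin D ->
    exists2 X : {set V}, v \in X & \sum_(v in X) f v == p X.
  move=> ov vz vD.
  have /negP nok : ~ ok (v |: D).
    move/Dmax=> /(_ (subsetUr _ _)) DE; by rewrite -DE !inE eqxx in vD.
  have sub : v |: D \subset [set v | odd (d v) & v != z].
    by apply/subsetP => w; rewrite !inE => /orP[/eqP->|/Dsub]; rewrite ?ov // inE.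
  move: nok; rewrite /ok sub /= negb_forall => /existsP[X]; rewrite -ltnNge => lt.
  have le := Dok X.
  have E : \sum_(w in X) f w = \sum_(w in X) lowered (v |: D) w + (v \in X).
    case vX: (v \in X); last first.
      rewrite addn0; apply: eq_bigr => w wX; rewrite /f /lowered !inE.
      by case: eqP => // wv; rewrite wv vX in wX.
    rewrite (bigD1 v) //= [in RHS](bigD1 v) //= addnAC; congr (_ + _).
      by rewrite /f /lowered !inE eqxx (negPf vD) /=; lia.
    apply: eq_bigr => w /andP[_ /negPf wv]; by rewrite /f /lowered !inE wv.
  by move: le lt; rewrite -/f; exists X; move: E; case: (v \in X); lia.
have tightU (X Y : {set V}) : \sum_(v in X) f v == p X ->
    \sum_(v in Y) f v == p Y -> X :&: Y != set0 ->
    \sum_(v in X :|: Y) f v == p (X :|: Y).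
  move=> /eqP tX /eqP tY XY; have := p_supermodular XY.
  have := sum_setUI f X Y.
  by have := Dok (X :&: Y); have := Dok (X :|: Y); rewrite -/f; lia.
(* Induction that peels disjoint tight sets off [W]. Once none is left, every odd vertex of [W]
   except [z] is in [D], and the bound holds vertex by vertex. *)
have key n (W : {set V}) : #|W| <= n ->
    (forall v, v \in W -> odd (d v) -> v != z -> v \notin D ->
      exists2 X : {set V}, v \in X & (X \subset W) && (\sum_(v in X) f v == p X)) ->
    2 * \sum_(v in W) f v <= \sum_(v in W) d v + (z \in W).
  elim: n => [|n IH] in W *.
    rewrite leqn0 cards_eq0 => /eqP -> _; by rewrite !big_set0.
  move=> cW cover.
  pose P (X : {set V}) := [&& X != set0, X \subset W & \sum_(v in X) f v == p X].
  have [/existsP[X0 PX0]|/existsPn noP] := boolP [exists X, P X]; last first.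
    have good v : v \in W -> 2 * f v <= d v + (v == z).
      move=> vW; rewrite /f /lowered; case vD: (v \in D).
        by have := fodd v vD; lia.
      case vz: (v == z); first by lia.
      case od: (odd (d v)); last by lia.
      have [||X vX /andP[XW tX]] := cover v vW od; rewrite ?vz ?vD //.
      case/negP: (noP X); rewrite /P XW tX !andbT; by apply/set0Pn; exists v.
    rewrite big_distrr /=; 
    apply: (@leq_trans (\sum_(v in W) (d v + (v == z)))).
      by apply: leq_sum.
    rewrite big_split /= leq_add2l; case zW: (z \in W).
      rewrite (bigD1 z) //= eqxx big1 // => v /andP[_ /negPf -> //].
    rewrite big1 // => v vW; case: eqP => // vz; by rewrite vz zW in vW.
  (* As [X] is a largest tight set, a tight set with a vertex outside [X] cannot meet it: their
     union would be tight and larger. So [W :\: X] is still covered. *)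
  have [X PX Xmax] := arg_maxnP (fun X : {set V} => #|X|) PX0.
  case/and3P: PX => X0' XW tX.
  rewrite !(sum_subsetD _ XW) mulnDr.
  have h1 : 2 * \sum_(v in X) f v <= \sum_(v in X) d v.
    by rewrite (eqP tX) p_le.
  have h2 : 2 * \sum_(v in W :\: X) f v <= \sum_(v in W :\: X) d v + (z \in W :\: X).
    apply: IH => [|v]; first by have := cardsD W X; rewrite (setIidPr XW); 
      move: X0'; rewrite -card_gt0; lia.
    rewrite inE => /andP[vX vW] od vz vD.
    have [Y vY /andP[YW tY]] := cover v vW od vz vD.
    exists Y => //; rewrite tY andbT subsetD YW /=.
    rewrite -setI_eq0; apply/negPn/negP => YX.
    have := Xmax (Y :|: X); rewrite /P subUset YW XW tightU //=.
    have -> : Y :|: X != set0 by apply/set0Pn; exists v; rewrite inE vY.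
    move=> /(_ isT); apply/negP; rewrite -ltnNge; apply: proper_card.
    apply/properP; split; first exact: subsetUr.
    by exists v => //; rewrite inE vY.
  by move: h1 h2; rewrite inE; case: (z \in X); case: (z \in W) => /=; lia.
have := key _ [set: V] (leqnn _).
rewrite (eq_bigl xpredT) => [|v]; last by rewrite inE.
rewrite (eq_bigl xpredT d) => [|v]; last by rewrite inE.
rewrite inE addn1; apply=> v _ od vz vD.
by have [X vX tX] := tight_bad v od vz vD; exists X; rewrite ?subsetT.
Qed.

End HalfRounding.

(** * Orientations with prescribed indegrees *)

Section Orientation.
Variable G : mgraph.
Notation V := (vertex G).
Notation E := (edge G).
Notation src e := (endpoints e).1.
Notation tgt e := (endpoints e).2.
Implicit Types (F T P : {set E}) (e : E) (v w z : V) (X Y U : {set V}).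
Implicit Types (o : E -> bool).

Definition hd o e : V := if o e then src e else tgt e.
Definition tl o e : V := if o e then tgt e else src e.
Definition indeg o F v : nat := \sum_(e in F) (hd o e == v).
Definition outdeg o F v : nat := \sum_(e in F) (tl o e == v).
Definition inner F X : nat :=
  \sum_(e in F) ((src e \in X) && (tgt e \in X)).
Definition entering o F X : nat :=
  \sum_(e in F) ((hd o e \in X) && (tl o e \notin X)).

Lemma degreeE o F v : degree F v = indeg o F v + outdeg o F v.
Proof.
rewrite /degree /indeg /outdeg -big_split /=; apply: eq_bigr => e _.
by rewrite /hd /tl; case: (o e) => //; rewrite addnC.
Qed.

Lemma sum_eq_mem X w : \sum_(v in X) (w == v) = (w \in X).
Proof.
case wX: (w \in X).
  by rewrite (bigD1 w) //= eqxx big1 // => v /andP[_ /negPf]; rewrite eq_sym => ->.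
by rewrite big1 // => v vX; case: eqP => // wv; rewrite wv vX in wX.
Qed.

Lemma sum_indeg o F X :
  \sum_(v in X) indeg o F v = entering o F X + inner F X.
Proof.
rewrite exchange_big -big_split /=; apply: eq_bigr => e _.
rewrite sum_eq_mem /hd /tl.
by case: (o e); case: (src e \in X); case: (tgt e \in X).
Qed.

Lemma entering_submodular o F X Y :
  entering o F (X :&: Y) + entering o F (X :|: Y) <=
  entering o F X + entering o F Y.
Proof.
rewrite /entering -!big_split /=; apply: leq_sum => e _; rewrite !inE.
by case: (hd o e \in X); case: (hd o e \in Y);
   case: (tl o e \in X); case: (tl o e \in Y).
Qed.

Lemma inner_supermodular F X Y :
  inner F X + inner F Y <= inner F (X :&: Y) + inner F (X :|: Y).
Proof.
rewrite /inner -!big_split /=; apply: leq_sum => e _; rewrite !inE.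
by case: (src e \in X); case: (src e \in Y);
   case: (tgt e \in X); case: (tgt e \in Y).
Qed.

Lemma innerD1 F e X : e \in F ->
  inner F X = inner (F :\ e) X + ((src e \in X) && (tgt e \in X)).
Proof. by move=> eF; rewrite /inner (big_setD1 e) //= addnC. Qed.

(* Hakimi's theorem: orient one edge at a time, keeping the cut condition. *)
Lemma orientation_with_indegrees F (f : V -> nat) :
    (forall X, inner F X <= \sum_(v in X) f v) -> \sum_v f v = #|F| ->
  exists o, forall v, indeg o F v = f v.
Proof.
move: {2}#|F| (erefl #|F|) => n; elim: n => [|n IH] in F f *.
  move=> F0 _; rewrite F0 => /eqP; rewrite sum_nat_eq0 => /forall_inP f0.
  exists xpredT => v; rewrite (eqP (f0 v isT)) /indeg.
  by move/eqP: F0; rewrite cards_eq0 => /eqP ->; rewrite big_set0.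
move=> cF hall tot.
have [F0|[e eF]] := set_0Vmem F; first by rewrite F0 cards0 in cF.
(* [free w] says that [e] can be directed into [w]: every set containing [w] keeps a unit of [f] to
   spare once [e] is removed. *)
pose free w := [forall X : {set V},
  (w \in X) ==> (inner (F :\ e) X < \sum_(v in X) f v)].
suff [b fb] : exists b : bool, free (if b then src e else tgt e).
  set w := if b then _ else _ in fb.
  have {}fb X : w \in X -> inner (F :\ e) X < \sum_(v in X) f v.
    by move/forallP/(_ X)/implyP: fb.
  have fw : 0 < f w.
    by have := fb [set w]; rewrite inE eqxx big_set1 => /(_ isT); lia.
  pose f' v := f v - (w == v).
  have fE v : f v = f' v + (w == v).
    by rewrite /f' subnK //; case: eqP => [<-|].
  have sumE X : \sum_(v in X) f v = \sum_(v in X) f' v + (w \in X).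
    by rewrite -sum_eq_mem -big_split /=; apply: eq_bigr => v _.
  have [|||o oP] := IH (F :\ e) f'.
  - by have := cardsD1 e F; rewrite eF cF; lia.
  - move=> X; have := hall X; rewrite (innerD1 _ eF).
    by have := fb X; rewrite sumE; case: (w \in X) => [/(_ isT)|_]; lia.
  - have := sumE setT; rewrite inE !sum_setT.
    by rewrite tot; have := cardsD1 e F; rewrite eF; lia.
  exists (fun e' => if e' == e then b else o e') => v.
  rewrite fE -oP /indeg (big_setD1 e) //= addnC; congr (_ + _).
    by apply: eq_bigr => e'; rewrite !inE => /andP[/negPf e'e _]; rewrite /hd e'e.
  by rewrite /hd eqxx /w.
(* If both ends are blocked, by [X] and [Y], uncrossing leaves no spare unit on [X :|: Y], which
   however contains both ends of [e]. *)
have [fs|] := boolP (free (src e)); first by exists true.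
rewrite negb_forall => /existsP[X]; rewrite negb_imply -leqNgt => /andP[sX hX].
have [ft|] := boolP (free (tgt e)); first by exists false.
rewrite negb_forall => /existsP[Y]; rewrite negb_imply -leqNgt => /andP[tY hY].
have := hall (X :&: Y); have := hall (X :|: Y); rewrite !(innerD1 _ eF) !inE sX tY.
have := sum_setUI f X Y; have := inner_supermodular (F :\ e) X Y.
by rewrite orbT /=; lia.
Qed.


(** * Parity of degrees and acyclicity *)

Lemma degreeD1 F e v : e \in F ->
  degree F v = degree (F :\ e) v + ((src e == v) + (tgt e == v)).
Proof.
by move=> eF; rewrite /degree (big_setD1 e) //= addnC.
Qed.

(** Each step flips the parity at its two ends, and the flips cancel inside the walk. A closed walk
    with distinct edges thus gives an edge set with all degrees even, which [even_free] rules
    out. *)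
Lemma odd_degree_walk F x p y : walk F x p y -> uniq [seq s.1 | s <- p] ->
  forall v, odd (degree [set e in [seq s.1 | s <- p]] v) = (x == v) (+) (y == v).
Proof.
elim: p => [|[e x'] p IH] in x * => /=.
  by move=> /eqP -> _ v; rewrite addbb /degree big1 // => e; rewrite inE.
case/and3P=> _ ej wp /andP[ep up] v.
rewrite (@degreeD1 _ e) ?inE ?eqxx //.
have -> : [set e0 in e :: [seq s.1 | s <- p]] :\ e = [set e0 in [seq s.1 | s <- p]].
  apply/setP => e0; rewrite !inE; case: eqP => //= ->; by rewrite (negPf ep).
rewrite oddD (IH _ wp up) oddD !oddb.
by case/orP: ej => /eqP -> /=; case: (x == v); case: (x' == v); case: (y == v).
Qed.

Lemma walk_edges F x p y : walk F x p y -> {subset [seq s.1 | s <- p] <= F}.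
Proof.
elim: p x => [|[e x'] p IH] x //= /and3P[eF _ wp] f.
by rewrite inE => /orP[/eqP -> //|]; apply: IH wp f.
Qed.

(* Equivalent to being a forest, but easier to maintain when adding a leaf. *)
Definition even_free T := forall P, P \subset T ->
  (forall v, ~~ odd (degree P v)) -> P = set0.

Lemma even_free_acyclic T : even_free T -> acyclic T.
Proof.
move=> ef x p [p0 wp ue _].
have sub : [set e in [seq s.1 | s <- p]] \subset T.
  by apply/subsetP => e; rewrite inE; apply: walk_edges wp e.
have := ef _ sub; case: p p0 wp ue {sub} => // -[e x'] p _ wp ue H.
have /setP/(_ e) : [set e0 in [seq s.1 | s <- (e, x') :: p]] = set0.
  by apply: H => v; rewrite (odd_degree_walk wp ue) addbb.
by rewrite !inE eqxx.
Qed.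

(** * Arborescences and Edmonds' theorem *)

Lemma joins_hd_tl o e : joins e (tl o e) (hd o e).
Proof.
by rewrite /joins /hd /tl; case: (o e); case: (endpoints e) => a b; rewrite eqxx ?orbT.
Qed.

Lemma adjacent_sym F : symmetric (adjacent F).
Proof.
by move=> x y; apply/exists_inP/exists_inP => -[e eF j]; exists e => //;
  rewrite /joins orbC.
Qed.

Lemma connect_adjacent_sub F F' x y : F \subset F' ->
  connect (adjacent F) x y -> connect (adjacent F') x y.
Proof.
move=> /subsetP FF'; apply: connect_sub => a b /exists_inP[e /FF' eF j].
by apply: connect1; apply/exists_inP; exists e.
Qed.

(** [U] is the set of vertices reached so far. Connectivity and [even_free] yield a spanning tree
    once [U] is everything; the indegrees reduce degrees in the tree to outdegrees. *)
Definition arborescence o z U T := [/\ z \in U,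
  {in T, forall e, (hd o e \in U) && (tl o e \in U)},
  forall v, indeg o T v = (v \in U) && (v != z),
  {in U, forall v, connect (adjacent T) z v} & even_free T].

Lemma arborescence_root o z : arborescence o z [set z] set0.
Proof.
split=> [|e|v|v|P]; rewrite ?inE //.
- by rewrite /indeg big_set0; case: eqP.
- by move=> /eqP ->; apply: connect0.
- by rewrite subset0 => /eqP.
Qed.

Lemma arborescence_add o z U T e : arborescence o z U T ->
  tl o e \in U -> hd o e \notin U -> arborescence o z (hd o e |: U) (e |: T).
Proof.
move=> [zU TU inT conT efT] tU hU.
have eT : e \notin T by apply/negP => /TU /andP[h _]; rewrite h in hU.
have sT : T \subset e |: T := subsetUr _ _.
split=> [|f|v|v|P PT ev].
- by rewrite inE zU orbT.
- rewrite !inE => /orP[/eqP ->|/TU/andP[-> ->]]; by rewrite ?eqxx ?tU !orbT.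
- rewrite /indeg big_setU1 //= -/(indeg o T v) inT !inE eq_sym.
  case: (eqVneq v (hd o e)) => [->|//].
  by rewrite (negPf hU) /= ; case: eqP => // hz; rewrite hz zU in hU.
- rewrite !inE => /orP[/eqP ->|vU]; last exact: connect_adjacent_sub (conT v vU).
  apply: connect_trans (connect_adjacent_sub sT (conT _ tU)) _.
  apply: connect1; apply/exists_inP; exists e; first by rewrite !inE eqxx.
  exact: joins_hd_tl.
have he v : (hd o e == v) + (tl o e == v) = (src e == v) + (tgt e == v) :> nat.
  by rewrite /hd /tl; case: (o e) => //; rewrite addnC.
(* The head of [e] is a leaf of [e |: T], so it would have degree 1 in an even set containing
   [e]. *)
have eP : e \notin P.
  apply/negP => eP; have := ev (hd o e).
  rewrite (degreeD1 _ eP) -he eqxx /degree big1 => [|f].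
    by case: eqP => // ht; rewrite ht (negPf hU) in tU.
  rewrite !inE => /andP[fe /(subsetP PT)]; rewrite !inE (negPf fe) /= => /TU.
  rewrite /hd /tl -/(hd o e).
  by case: (o f) => /andP[h1 h2]; do 2![case: eqP => [E1|_]; first by
    rewrite E1 ?(negPf hU) in h1 h2].
apply: efT ev; apply/subsetP => f fP; have := subsetP PT f fP.
by rewrite !inE; case: eqP => // fe; rewrite fe (negPf eP) in fP.
Qed.

Lemma entering_setD o F T X :
  {in T, forall e, hd o e \notin X} -> T \subset F -> entering o (F :\: T) X = entering o F X.
Proof.
move=> TX TF; rewrite /entering [RHS](big_setID T) /= (setIidPr TF) [X in X + _]big1 ?add0n //.
by move=> e /TX /negPf ->.
Qed.

(* Lovász's proof: a minimal tight set containing vertices not yet reached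
   provides an arc that can be added to the arborescence. *)
Lemma arborescence_grow o z F k U T :
    (forall X, X != set0 -> z \notin X -> k < entering o F X) ->
    T \subset F -> arborescence o z U T ->
    (forall X, X != set0 -> z \notin X -> k <= entering o (F :\: T) X) ->
    U != setT ->
  exists e, [/\ e \in F, tl o e \in U, hd o e \notin U
   & forall X, X != set0 -> z \notin X -> k <= entering o (F :\: (e |: T)) X].
Proof.
move=> conn TF arb tight UT; have [zU TU inT _ _] := arb.
pose crit X := ~~ (X \subset U) &&
  ((X == setT) || ((z \notin X) && (entering o (F :\: T) X == k))).
have critT : crit setT by rewrite /crit eqxx subTset UT.
have [X /andP[XU Xc] Xmin] := arg_minnP (fun X : {set V} => #|X|) critT.
have [w wX wU] := subsetPn XU.
have zXU : z \notin X :\: U by rewrite inE zU.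
(* No arc of [T] has its head outside [U], so [X :\: U] is still entered by more than [k] arcs. As
   fewer arcs enter [X], some arc goes from [X :&: U] to [X :\: U]. *)
have ltXU : entering o (F :\: T) X < entering o (F :\: T) (X :\: U) \/ X = setT.
  have [->|/negPf XT] := eqVneq X setT; [by right | left].
  move: Xc; rewrite XT => /andP[_ /eqP ->].
  rewrite entering_setD //; last by move=> e /TU /andP[h _]; rewrite inE h.
  by apply: conn => //; apply/set0Pn; exists w; rewrite inE wX wU.
have [e eFT /and3P[hX hU tXU]] : exists2 e, e \in F :\: T &
    [&& hd o e \in X, hd o e \notin U & tl o e \in X :&: U].
  apply/exists_inP; apply: contraT; rewrite negb_exists_in => /forall_inP no.
  have le0 : entering o (F :\: T) (X :\: U) <= entering o (F :\: T) X.
    apply: leq_sum => e /no; rewrite !inE.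
    by case: (hd o e \in X); case: (hd o e \in U); case: (tl o e \in X); case: (tl o e \in U).
  case: ltXU => [|XE]; first by rewrite ltnNge le0.
  have : 0 < entering o (F :\: T) (X :\: U).
    rewrite entering_setD //; last by move=> e /TU /andP[h _]; rewrite inE h.
    by apply: leq_ltn_trans (conn _ _ zXU) => //; apply/set0Pn; exists w; rewrite inE wX wU.
  move/leq_trans/(_ le0); rewrite XE /entering big1 // => e _; by rewrite !inE andbF.
move: tXU; rewrite inE => /andP[tX tU].
move: eFT; rewrite inE => /andP[eT eF].
exists e; split=> // Y Y0 zY.
have eFT : e \in F :\: T by rewrite inE eT eF.
have FE : F :\: (e |: T) = (F :\: T) :\ e.
  by apply/setP => f; rewrite !inE negb_or andbA.
have := tight Y Y0 zY; rewrite FE /entering (big_setD1 e) //=.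
case hY: (hd o e \in Y); case tY: (tl o e \in Y) => //=.
rewrite leq_eqVlt => /orP[/eqP kE|//]; exfalso.
have enY : entering o (F :\: T) Y = k by rewrite /entering (big_setD1 e) //= hY tY -kE.
(* If losing [e] hurts [Y], then [Y] is tight, and by submodularity so is [X :&: Y]: a critical set
   smaller than [X], since it misses the tail of [e]. *)
have critXY : crit (X :&: Y).
  apply/andP; split; first by apply/subsetPn; exists (hd o e); rewrite // inE hX.
  have zXY : z \notin X :&: Y by rewrite inE (negPf zY) andbF.
  have XY0 : X :&: Y != set0 by apply/set0Pn; exists (hd o e); rewrite inE hX.
  rewrite zXY /=; have := tight _ XY0 zXY.
  case/orP: Xc => [/eqP XE|/andP[zX /eqP enX]].
    by rewrite XE setTI enY eqxx orbT.
  have XUY0 : X :|: Y != set0 by apply/set0Pn; exists w; rewrite inE wX.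
  have zXUY : z \notin X :|: Y by rewrite inE negb_or zX.
  have := tight _ XUY0 zXUY; have := entering_submodular o (F :\: T) X Y.
  rewrite enX enY => h1 h2 h3; apply/orP; right; rewrite eqn_leq h3 andbT.
  by rewrite -(leq_add2r k) (leq_trans _ h1) // leq_add2l.
have := Xmin _ critXY; apply/negP; rewrite -ltnNge; apply: proper_card.
apply/properP; split; first exact: subsetIl.
by exists (tl o e); rewrite // inE tY andbF.
Qed.

Lemma spanning_arborescence o z F k :
    (forall X, X != set0 -> z \notin X -> k < entering o F X) ->
  exists T, [/\ T \subset F, arborescence o z setT T &
    forall X, X != set0 -> z \notin X -> k <= entering o (F :\: T) X].
Proof.
move=> conn.
suff grow n U T : #|~: U| <= n -> T \subset F -> arborescence o z U T ->
    (forall X, X != set0 -> z \notin X -> k <= entering o (F :\: T) X) ->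
  exists T, [/\ T \subset F, arborescence o z setT T &
    forall X, X != set0 -> z \notin X -> k <= entering o (F :\: T) X].
  apply: (grow _ [set z] set0 (leqnn _)).
  - exact: sub0set.
  - exact: arborescence_root.
  - by move=> X X0 zX; rewrite setD0 ltnW // conn.
elim: n => [|n IH] in U T *.
  rewrite leqn0 cards_eq0 -subset0 -setCS setC0 setCK subTset => /eqP ->.
  by exists T.
move=> cU TF arb tight.
have [UT|UT] := eqVneq U setT; first by exists T; rewrite -UT.
have [e [eF tU hU tight']] := arborescence_grow conn TF arb tight UT.
apply: (IH (hd o e |: U) (e |: T)) => //; last exact: arborescence_add.
  rewrite -ltnS; apply: leq_trans cU; apply: proper_card; rewrite properC.
  by apply/properP; split; [exact: subsetUr | exists (hd o e); rewrite // !inE eqxx].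
by apply/subsetP => f; rewrite !inE => /orP[/eqP ->|/(subsetP TF)].
Qed.

(** Edmonds' branching theorem: arborescences are split off one at a time, each lowering the
    guaranteed number of entering arcs by only one. *)
Lemma disjoint_arborescences o z F k :
    (forall X, X != set0 -> z \notin X -> k <= entering o F X) ->
  exists T : nat -> {set E},
    (forall i, i < k -> T i \subset F /\ arborescence o z setT (T i)) /\
    (forall i j, i < k -> j < k -> i != j -> [disjoint T i & T j]).
Proof.
elim: k => [|k IH] in F * => conn; first by exists (fun=> set0).
have [T0 [T0F arb0 conn0]] := spanning_arborescence conn.
have [T [TP Td]] := IH _ conn0.
exists (fun i => if i is j.+1 then T j else T0); split=> [[|i] ik|[|i] [|j] ik jk ij] //.
- by have [/subset_trans -> //] := TP i ik; rewrite subsetDl.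
- by rewrite disjoint_sym; case: (TP j jk); rewrite subsetD => /andP[].
- by case: (TP i ik); rewrite subsetD => /andP[].
- exact: Td.
Qed.

Lemma arborescence_spanning_tree o z T : arborescence o z setT T -> spanning_tree T.
Proof.
move=> [_ _ _ con ef]; split; last exact: even_free_acyclic.
have sym := sym_connect_sym (@adjacent_sym T).
by move=> x y; apply: (@connect_trans _ _ z); [rewrite sym|]; apply: con; rewrite inE.
Qed.

(** A path from [z] to another vertex starts with an edge at [z], and the root has indegree 0, so
    this edge is directed away from it. *)
Lemma outdeg_root_gt0 o z T : arborescence o z setT T -> 1 < #|V| -> 0 < outdeg o T z.
Proof.
move=> [_ _ inT con _] V1.
have [x xz] : exists x, x != z.
  apply/existsP; apply: contraLR V1; rewrite negb_exists -leqNgt => /forallP xz.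
  rewrite -cardsT -(cards1 z); apply: subset_leq_card.
  by apply/subsetP => x _; rewrite inE; have := xz x; rewrite negbK.
have /connectP[[|y p] /= yp xE] := con x (in_setT x); first by rewrite xE eqxx in xz.
case/andP: yp => /exists_inP[e eT j] _.
have hz : hd o e != z.
  apply/negP => hz; have := inT z; rewrite /indeg (big_setD1 e) //= hz.
  by rewrite inE eqxx.
rewrite /outdeg (big_setD1 e) //=.
suff -> : tl o e == z by [].
move: hz j; rewrite /joins /hd /tl; case: (o e); case: (endpoints e) => a b /= hz.
  by case/orP=> /eqP[E1 E2]; rewrite ?E1 ?E2 ?eqxx // in hz *.
by case/orP=> /eqP[E1 E2]; rewrite ?E1 ?E2 ?eqxx // in hz *.
Qed.

End Orientation.

(** * Two-colouring edges under degree bounds for each colour *)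

Section Split.
Variable G : mgraph.
Notation V := (vertex G).
Notation E := (edge G).
Notation src e := (endpoints e).1.
Notation tgt e := (endpoints e).2.
Implicit Types (F : {set E}) (e : E) (v w z : V) (b c : bool).
Implicit Types (p q : {ffun V -> option bool}) (Bd : bool -> V -> nat).

Lemma degree_filter F (Q : pred E) v : degree [set e in F | Q e] v =
  \sum_(e in F) Q e * ((src e == v) + (tgt e == v)).
Proof.
rewrite /degree big_mkcond [RHS]big_mkcond; apply: eq_bigr => e _; rewrite inE.
by case: (e \in F) => //=; case: (Q e); rewrite ?mul1n.
Qed.

Lemma degree_sumM F (D : V -> nat) :
  \sum_v D v * degree F v = \sum_(e in F) (D (src e) + D (tgt e)).
Proof.
under eq_bigr do rewrite big_distrr /=.
rewrite exchange_big /=; apply: eq_bigr => e _.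
under eq_bigr do rewrite mulnDr; rewrite big_split /=.
have H w : \sum_v D v * (w == v) = D w.
  rewrite (bigD1 w) //= eqxx muln1 big1 ?addn0 // => v /negPf.
  by rewrite eq_sym => ->; rewrite muln0.
by rewrite !H.
Qed.

Definition opposed (a b : option bool) : bool :=
  if (a, b) is (Some i, Some j) then i != j else false.

(* [p] encodes a pair of disjoint vertex sets, [p v = None] meaning that [v] is
   in neither of them; [Bd b v] bounds the number of edges of colour [b] at [v]. *)
Definition crossing F p : nat :=
  \sum_(e in F) opposed (p (src e)) (p (tgt e)).

Definition weight Bd p : nat :=
  \sum_v (if p v is Some b then Bd b v else 0).

(** These are the operations of bisubmodularity on pairs of disjoint sets: intersect both
    components, or unite them and drop the vertices that would land in both. *)
Definition meet_sign (a b : option bool) := if a == b then a else None.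
Definition join_sign (a b : option bool) :=
  if a is Some _ then if opposed a b then None else a else b.

Lemma crossingD1 F e p : e \in F ->
  crossing F p = crossing (F :\ e) p + opposed (p (src e)) (p (tgt e)).
Proof. by move=> eF; rewrite /crossing (big_setD1 e) //= addnC. Qed.

(** Only opposed vertices lose weight: they contribute both bounds on the left and become [None] in
    both the meet and the join. In [crossing_uncross] the lost edges are charged to the same
    vertices. *)
Lemma weight_uncross Bd p q :
  weight Bd p + weight Bd q =
    weight Bd [ffun v => meet_sign (p v) (q v)] +
    weight Bd [ffun v => join_sign (p v) (q v)] +
    \sum_v opposed (p v) (q v) * (Bd true v + Bd false v).
Proof.
rewrite /weight -!big_split /=; apply: eq_bigr => v _; rewrite !ffunE.
by case: (p v) => [[]|]; case: (q v) => [[]|] //=; lia.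
Qed.

Lemma crossing_uncross F p q :
  crossing F p + crossing F q <=
    crossing F [ffun v => meet_sign (p v) (q v)] +
    crossing F [ffun v => join_sign (p v) (q v)] +
    \sum_(e in F) (opposed (p (src e)) (q (src e)) +
                   opposed (p (tgt e)) (q (tgt e))).
Proof.
rewrite /crossing -!big_split /=; apply: leq_sum => e _; rewrite !ffunE.
by case: (p (src e)) => [[]|]; case: (q (src e)) => [[]|];
   case: (p (tgt e)) => [[]|]; case: (q (tgt e)) => [[]|].
Qed.

(* [p] certifies that the edge [e] cannot receive the colour [b]. *)
Definition obstructs Bd F e b p : bool :=
  weight Bd p <
    crossing (F :\ e) p + ((p (src e) == Some b) + (p (tgt e) == Some b)).

(** Add the two obstructions and uncross. The edges lost are paid for at opposed vertices, where the
    two bounds sum to the degree plus, away from [z], one unit. That unit is missing at [z], so if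
    [e] meets [z], each obstruction may mark only one end of [e]. *)
Lemma obstruction_conflict Bd F e z p q :
    e \in F -> src e != tgt e ->
    (forall p, crossing F p <= weight Bd p) ->
    (forall v, degree F v + (v != z) <= Bd true v + Bd false v) ->
    (z \in [:: src e; tgt e] ->
       (p (src e) == Some true) + (p (tgt e) == Some true) <= 1 /\
       (q (src e) == Some false) + (q (tgt e) == Some false) <= 1) ->
  obstructs Bd F e true p -> obstructs Bd F e false q -> False.
Proof.
move=> eF nl hall slack small; rewrite /obstructs => op oq.
have h1 := hall p; have h2 := hall q.
have h3 := hall [ffun v => meet_sign (p v) (q v)].
have h4 := hall [ffun v => join_sign (p v) (q v)].
have h5 := weight_uncross Bd p q.
have h6 := crossing_uncross (F :\ e) p q.
pose D v : nat := opposed (p v) (q v).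
have h7 : \sum_(e in F) (D (src e) + D (tgt e)) + \sum_v D v * (v != z) <=
          \sum_v D v * (Bd true v + Bd false v).
  rewrite -degree_sumM -big_split /=; apply: leq_sum => v _.
  by rewrite -mulnDr leq_mul2l slack orbT.
have h8 : D (src e) * (src e != z) + D (tgt e) * (tgt e != z) <=
          \sum_v D v * (v != z).
  by rewrite (bigD1 (src e)) //= leq_add2l (bigD1 (tgt e)) 1?eq_sym //= leq_addr.
rewrite (big_setD1 e) //= in h7.
rewrite !(crossingD1 _ eF) !ffunE in h1 h2 h3 h4.
move: small h1 h2 h3 h4 h5 h6 h7 h8 op oq; rewrite /D !inE !(eq_sym z).
set w3 := weight _ [ffun _ => _]; set w4 := weight _ [ffun _ => join_sign _ _].
set c3 := crossing _ [ffun _ => _]; set c4 := crossing _ [ffun _ => join_sign _ _].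
move: (weight Bd p) (weight Bd q) w3 w4 => w1 w2 w3 w4.
move: (crossing _ p) (crossing _ q) c3 c4 => c1 c2 c3 c4.
set s1 := \sum_v _; set s2 := \sum_(i in _) _; set s3 := \sum_v _.
move: s1 s2 s3 => s1 s2 s3.
have zz : src e == z -> tgt e == z -> False.
  by move=> /eqP a /eqP b; move: nl; rewrite a b eqxx.
move: zz.
(* Only the signs at the ends of [e] matter now. The tight case is that [p] marks one end and [q]
   the other; then [e] itself crosses the join. *)
case: (p (src e)) => [[]|]; case: (q (src e)) => [[]|];
   case: (p (tgt e)) => [[]|]; case: (q (tgt e)) => [[]|];
   case: (src e == z); case: (tgt e == z) => //=; lia.
Qed.


(* When all edges meet [z], an end other than [z] can be left out of an
   obstruction that contains both ends of [e]. *)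
Lemma star_obstruction Bd F e z b p :
    src e != tgt e -> z \in [:: src e; tgt e] ->
    {in F, forall e, (src e == z) || (tgt e == z)} ->
  obstructs Bd F e b p -> exists2 q, obstructs Bd F e b q &
    (q (src e) == Some b) + (q (tgt e) == Some b) <= 1.
Proof.
move=> nl ze star op.
have [small|] := leqP ((p (src e) == Some b) + (p (tgt e) == Some b)) 1.
  by exists p.
case pu: (p (src e) == Some b); case pv: (p (tgt e) == Some b) => // _.
move/eqP: pu => pu; move/eqP: pv => pv.
have pz : p z = Some b by move: ze; rewrite !inE => /orP[] /eqP ->.
pose o := if src e == z then tgt e else src e.
have oz : o != z.
  by rewrite /o; case: ifP => [/eqP <-|->] //; rewrite eq_sym.
have po : p o = Some b by rewrite /o; case: ifP.
have cnt (q : {ffun V -> option bool}) :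
    (q (src e) == Some b) + (q (tgt e) == Some b) =
    (q o == Some b) + (q z == Some b).
  move: ze; rewrite !inE /o ![z == _]eq_sym; case: ifP => [/eqP <- _|_ /eqP <-] //.
  by rewrite addnC.
(* If [o] has no capacity left, it is an obstruction by itself. Otherwise dropping it from [p] saves
   at least the unit lost at the end of [e], and no crossing edge, as edges at [o] lead to [z],
   which has the same sign. *)
have [Bo|Bo] := posnP (Bd b o).
  exists [ffun v => if v == o then Some b else None].
    rewrite /obstructs cnt !ffunE eqxx [z == o]eq_sym (negPf oz) /= addn0.
    rewrite /weight big1 ?eqxx ?addn1 // => v _; rewrite ffunE.
    by case: eqP => // ->.
  by rewrite cnt !ffunE eqxx [z == o]eq_sym (negPf oz) eqxx.
exists [ffun v => if v == o then None else p v]; last first.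
  by rewrite cnt !ffunE eqxx [z == o]eq_sym (negPf oz) leq_b1.
move: op; rewrite /obstructs !cnt !ffunE eqxx [z == o]eq_sym (negPf oz) pz po.
rewrite eqxx /=.
have -> : weight Bd p =
    weight Bd [ffun v => if v == o then None else p v] + Bd b o.
  rewrite /weight [in LHS](bigD1 o) //= [in RHS](bigD1 o) //= po ffunE eqxx.
  rewrite add0n addnC; congr (_ + _); apply: eq_bigr => v /negPf vo.
  by rewrite ffunE vo.
have : crossing (F :\ e) p <=
    crossing (F :\ e) [ffun v => if v == o then None else p v].
  apply: leq_sum => f; rewrite inE => /andP[_ /star]; rewrite !ffunE.
  case: (eqVneq (src f) o) => [->|_].
    by rewrite (negPf oz) /= => /eqP ->; rewrite po pz; case: (b).
  case: (eqVneq (tgt f) o) => [->|_] //.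
  by rewrite (negPf oz) orbF => /eqP ->; rewrite po pz; case: (b).
lia.
Qed.

(** Absence of obstructions is exactly the Hall-type condition after charging [e] to the bounds of
    colour [c]; degrees and sums of bounds drop together, which preserves the slack. *)
Lemma colour_edge Bd F e c z :
    e \in F ->
    (forall v, degree F v + (v != z) <= Bd true v + Bd false v) ->
    (forall p, ~~ obstructs Bd F e c p) ->
  exists Bd' : bool -> V -> nat,
   [/\ forall p, crossing (F :\ e) p <= weight Bd' p,
      forall v, degree (F :\ e) v + (v != z) <= Bd' true v + Bd' false v
    & forall b v, Bd b v = Bd' b v + (b == c) * ((src e == v) + (tgt e == v))].
Proof.
move=> eF slack free.
have {}free p : crossing (F :\ e) p +
    ((p (src e) == Some c) + (p (tgt e) == Some c)) <= weight Bd p.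
  by rewrite leqNgt; apply: free.
(* Testing the single vertex [v] shows that the subtraction in [Bd'] is not truncated. *)
have room v : (src e == v) + (tgt e == v) <= Bd c v.
  have := free [ffun w => if w == v then Some c else None].
  have -> : weight Bd [ffun w => if w == v then Some c else None] = Bd c v.
    rewrite /weight (bigD1 v) //= ffunE eqxx big1 ?addn0 // => w /negPf wv.
    by rewrite ffunE wv.
  rewrite !ffunE => /(leq_trans _); apply; apply: leq_trans (leq_addl _ _).
  by do 2![case: eqP => _]; rewrite /= ?eqxx.
pose Bd' b v := Bd b v - (b == c) * ((src e == v) + (tgt e == v)).
have BdE b v : Bd b v = Bd' b v + (b == c) * ((src e == v) + (tgt e == v)).
  by rewrite /Bd' subnK //; case: eqP => [->|_] //; rewrite mul1n.
exists Bd'; split => // [p|v].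
  have := free p.
  suff -> : weight Bd p =
      weight Bd' p + ((p (src e) == Some c) + (p (tgt e) == Some c)).
    by rewrite leq_add2r.
  have pick w : (p w == Some c) = \sum_v (p v == Some c) * (w == v) :> nat.
    rewrite (bigD1 w) //= eqxx muln1 big1 ?addn0 // => v /negPf.
    by rewrite eq_sym => ->; rewrite muln0.
  rewrite !pick -!big_split /=; apply: eq_bigr => v _; rewrite -mulnDr.
  by case: (p v) => [b|] //; rewrite BdE.
have := slack v; rewrite (degreeD1 _ eF) !BdE.
by case: (c) => /=; lia.
Qed.

(* The edges avoiding [z] are coloured first: both of their ends have one unit
   of slack, which excludes parity obstructions. What is left is a star. *)
Lemma edge_two_colouring Bd F z :
    {in F, forall e, src e != tgt e} ->
    (forall p, crossing F p <= weight Bd p) ->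
    (forall v, degree F v + (v != z) <= Bd true v + Bd false v) ->
  exists col : E -> bool,
    forall b v, degree [set e in F | col e == b] v <= Bd b v.
Proof.
move: {2}#|F| (leqnn #|F|) => n; elim: n => [|n IH] in F Bd *.
  rewrite leqn0 cards_eq0 => /eqP -> _ _ _; exists xpredT => b v.
  by rewrite /degree big1 // => e; rewrite !inE.
move=> cF nl hall slack.
have [->|[e0 e0F]] := set_0Vmem F.
  exists xpredT => b v.
  by rewrite /degree big1 // => e; rewrite !inE.
suff [e eF [c free]] : exists2 e, e \in F &
    exists c, forall p, ~~ obstructs Bd F e c p.
  have [Bd' [hall' slack' BdE]] := colour_edge eF slack free.
  have [||col colP] := IH (F :\ e) Bd' _ _ hall' slack'.
  - by rewrite (cardsD1 e) eF in cF; lia.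
  - by move=> f; rewrite inE => /andP[_]; apply: nl.
  exists (fun f => if f == e then c else col f) => b v.
  rewrite BdE degree_filter (big_setD1 e) //= eqxx eq_sym addnC.
  apply: leq_add => //; apply: leq_trans (colP b v); rewrite degree_filter.
  by apply: leq_sum => f; rewrite !inE => /andP[/negPf ->].
have decide e : (exists c, forall p, ~~ obstructs Bd F e c p) \/
    (exists p, obstructs Bd F e true p) /\ (exists p, obstructs Bd F e false p).
  have [/existsP o1|/existsPn] := boolP [exists p, obstructs Bd F e true p];
    last by left; exists true.
  have [/existsP o2|/existsPn] := boolP [exists p, obstructs Bd F e false p];
    last by left; exists false.
  by right.
have [/exists_inP[e eF ze]|] :=
    boolP [exists e in F, (src e != z) && (tgt e != z)].
  exists e => //; have [//|[[p op] [q oq]]] := decide e; exfalso.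
  apply: (obstruction_conflict eF (nl e eF) hall slack _ op oq).
  by case/andP: ze; rewrite !inE ![z == _]eq_sym => /negPf -> /negPf ->.
rewrite negb_exists_in => /forall_inP star.
have {}star : {in F, forall e, (src e == z) || (tgt e == z)}.
  by move=> e /star; rewrite negb_and !negbK.
have ze : z \in [:: src e0; tgt e0].
  by rewrite !inE ![z == _]eq_sym star.
exists e0 => //; have [//|[[p op] [q oq]]] := decide e0; exfalso.
have [p' op' sp] := star_obstruction (nl e0 e0F) ze star op.
have [q' oq' sq] := star_obstruction (nl e0 e0F) ze star oq.
exact: (obstruction_conflict e0F (nl e0 e0F) hall slack _ op' oq').
Qed.

End Split.

(** * The loopless case: orientation, reserved trees and colouring *)

Section Main.
Variable G : mgraph.
Notation V := (vertex G).
Notation E := (edge G).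
Notation src e := (endpoints e).1.
Notation tgt e := (endpoints e).2.
Implicit Types (F H T : {set E}) (e : E) (v z : V) (X Y : {set V}).

Definition nonloops : {set E} := [set e | src e != tgt e].

Definition cut F X : nat := \sum_(e in F) ((src e \in X) != (tgt e \in X)).

Lemma sum_degree F X : \sum_(v in X) degree F v = 2 * inner F X + cut F X.
Proof.
rewrite /degree exchange_big /inner big_distrr -big_split /=.
apply: eq_bigr => e _; rewrite big_split /= !sum_eq_mem.
by case: (src e \in X); case: (tgt e \in X).
Qed.

Lemma edge_connected_cut n X : edge_connected n G -> X != set0 -> X != setT ->
  n <= cut nonloops X.
Proof.
move=> hG /set0Pn[x xX]; rewrite -subTset => /subsetPn[y _ yX].
pose C := [set e | (src e \in X) != (tgt e \in X)].
have -> : cut nonloops X = #|C|.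
  rewrite -sum1_card /cut big_mkcond [RHS]big_mkcond; apply: eq_bigr => e _.
  by rewrite !inE; case: (eqVneq (src e) (tgt e)) => [->|_] /=; [rewrite eqxx|case: ifP].
rewrite leqNgt; apply/negP => /hG /(_ x y).
have cl : closed (adjacent (~: C)) (mem X).
  move=> a b /exists_inP[e]; rewrite !inE negbK => /eqP eX.
  by case/orP=> /eqP E; move: eX; rewrite E.
by move/(closed_connect cl); rewrite /= xX (negPf yX).
Qed.

Lemma degree_nonloops_ge n z : edge_connected n G -> 1 < #|V| ->
  n <= degree nonloops z.
Proof.
move=> hG V1.
have zT : [set z] != [set: V].
  by apply/eqP => zT; move: V1; rewrite -cardsT -zT cards1.
have z0 : [set z] != set0 by apply/set0Pn; exists z; rewrite inE.
have := edge_connected_cut hG z0 zT; have := sum_degree nonloops [set z].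
by rewrite big_set1; lia.
Qed.

Lemma half_degree_orientation k z : edge_connected (2 * k) G ->
  exists o : E -> bool,
  [/\ forall v, outdeg o nonloops v <= uphalf (degree nonloops v),
      outdeg o nonloops z <= (degree nonloops z)./2
    & forall X, X != set0 -> z \notin X -> k <= entering o nonloops X].
Proof.
move=> hG; pose d := degree nonloops.
(* Indegrees summed over [X] count inner edges and entering arcs, so demanding [k] beyond the inner
   edges forces [k] entering arcs. *)
pose p X := inner nonloops X + ((X != set0) && (z \notin X)) * k.
have p_super X Y : X :&: Y != set0 -> p X + p Y <= p (X :&: Y) + p (X :|: Y).
  move=> XY0; have := inner_supermodular nonloops X Y.
  have ne (Z : {set V}) : X :&: Y \subset Z -> Z != set0.
    move=> sZ; apply: contraNneq XY0 => Z0; by rewrite -subset0 -Z0.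
  rewrite /p XY0 (ne X) ?subsetIl // (ne Y) ?subsetIr // (ne (X :|: Y)); last first.
    by apply: subset_trans (subsetIl _ _) (subsetUl _ _).
  by rewrite !inE; case: (z \in X); case: (z \in Y) => /=; lia.
have p_le X : 2 * p X <= \sum_(v in X) d v.
  rewrite sum_degree /p; case: (boolP (_ && _)) => [/andP[X0 zX]|_]; last by lia.
  have XT : X != setT by apply: contraNneq zX => ->; rewrite inE.
  by have := edge_connected_cut hG X0 XT; lia.
have [f [fd fz fp ftot]] := half_rounding z p_super p_le.
have cutT : cut nonloops [set: V] = 0 by rewrite /cut big1 // => e _; rewrite !inE.
have innerT : inner nonloops [set: V] = #|nonloops|.
  by rewrite -sum1_card; apply: eq_bigr => e _; rewrite !inE.
(* The demand on the whole vertex set gives one inequality; for the other, the excess of one in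
   [ftot] disappears by parity. *)
have tot : \sum_v f v = #|nonloops|.
  have := fp setT; rewrite /p inE andbF innerT sum_setT.
  have := sum_degree nonloops setT; rewrite sum_setT innerT cutT.
  by move: ftot; rewrite /d; lia.
have hall X : inner nonloops X <= \sum_(v in X) f v.
  by apply: leq_trans (fp X); apply: leq_addr.
have [o oP] := orientation_with_indegrees hall tot.
exists o; split=> [v||X X0 zX].
- have := degreeE o nonloops v; rewrite oP; have := fd v; rewrite /d; lia.
- have := degreeE o nonloops z; rewrite oP fz /d; move: (degree _ z) (outdeg _ _ z) => a b; lia.
have := sum_indeg o nonloops X; under eq_bigr do rewrite oP.
by have := fp X; rewrite /p X0 zX mul1n; lia.
Qed.

(** Charge each crossing edge to its tail: the tail lies in one of the two sets, and its outdegree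
    is within the bound of either colour. *)
Lemma crossing_le_weight o (Bd : bool -> V -> nat) F (p : {ffun V -> option bool}) :
  (forall b v, outdeg o F v <= Bd b v) -> crossing F p <= weight Bd p.
Proof.
move=> le; apply: (@leq_trans (\sum_(v in [set v | p v != None]) outdeg o F v)).
  rewrite /outdeg exchange_big /=; apply: leq_sum => e _.
  rewrite sum_eq_mem inE /tl.
  by case: (o e); case: (p (src e)) => [[]|]; case: (p (tgt e)) => [[]|].
rewrite /weight big_mkcond; apply: leq_sum => v _; rewrite inE.
by case: (p v) => [b|] /=; rewrite ?le.
Qed.

Lemma arborescences_union o z n (T : 'I_n -> {set E}) :
    (forall i, arborescence o z setT (T i)) ->
    (forall i j, i != j -> [disjoint T i & T j]) ->
    let U := \bigcup_i T i in
  [/\ tree_connected n U, forall v, indeg o U v = n * (v != z)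
    & 1 < #|V| -> n <= outdeg o U z].
Proof.
move=> arb dis U; split=> [|v|V1].
- exists T; split=> // i; last exact: arborescence_spanning_tree (arb i).
  exact: bigcup_sup.
- rewrite /indeg /U partition_disjoint_bigcup //=.
  under eq_bigr => i _ do [have [_ _ /(_ v) + _ _] := arb i; rewrite /indeg => ->].
  by rewrite inE sum_nat_const card_ord.
- rewrite /outdeg /U partition_disjoint_bigcup //=.
  rewrite -[leqLHS](card_ord n) -sum1_card; apply: leq_sum => i _.
  exact: outdeg_root_gt0 (arb i) V1.
Qed.

Lemma tree_connected_sub n F H : F \subset H -> tree_connected n F -> tree_connected n H.
Proof.
move=> FH [T [TF ? ?]]; exists T; split=> // i; exact: subset_trans (TF i) FH.
Qed.

Lemma loopless_factor m m0 z t :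
    0 < m + m0 -> edge_connected (2 * (m + m0)) G -> 1 < #|V| ->
    (degree nonloops z)./2 <= t + m0 -> t <= uphalf (degree nonloops z) + m ->
  exists H, [/\ H \subset nonloops, tree_connected m H,
    tree_connected m0 (nonloops :\: H), degree H z = t
    & forall v, (degree nonloops v)./2 <= degree H v + m0 /\
                degree H v <= uphalf (degree nonloops v) + m].
Proof.
move=> k0 hG V1 tlo thi.
have [o [outd outz conn]] := half_degree_orientation z hG.
have [T [TP Td]] := disjoint_arborescences conn.
have [||tc1 in1 out1] := @arborescences_union o z m (fun i => T i).
- by move=> i; case: (TP i) => //; have := ltn_ord i; lia.
- by move=> i j ij; apply: Td => //; have := ltn_ord i; have := ltn_ord j; lia.
have [||tc2 in2 out2] := @arborescences_union o z m0 (fun i => T (m + i)).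
- by move=> i; case: (TP (m + i)) => //; have := ltn_ord i; lia.
- move=> i j ij; have := ltn_ord i; have := ltn_ord j => ? ?.
  by apply: Td; rewrite ?ltn_add2l // eqn_add2l.
move: {out1}(out1 V1) {out2}(out2 V1) => out1 out2.
set T1 := \bigcup_i _ in tc1 in1 out1; set T2 := \bigcup_i _ in tc2 in2 out2.
have T1n : T1 \subset nonloops.
  by apply/bigcupsP => i _; case: (TP i) => //; have := ltn_ord i; lia.
have T2n : T2 \subset nonloops.
  by apply/bigcupsP => i _; case: (TP (m + i)) => //; have := ltn_ord i; lia.
have T12 : [disjoint T2 & T1].
  apply/bigcup_disjointP => i _; rewrite disjoint_sym.
  apply/bigcup_disjointP => j _; have := ltn_ord i; have := ltn_ord j => ? ?.
  by apply: Td; lia.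
have T2n' : T2 \subset nonloops :\: T1 by rewrite subsetD T2n.
set R := nonloops :\: T1 :\: T2.
have splitE (f : E -> nat) : \sum_(e in nonloops) f e =
    \sum_(e in T1) f e + (\sum_(e in T2) f e + \sum_(e in R) f e).
  by rewrite (sum_subsetD _ T1n) (sum_subsetD _ T2n').
have degE v : degree nonloops v = degree T1 v + (degree T2 v + degree R v).
  exact: splitE.
have outE v : outdeg o nonloops v = outdeg o T1 v + (outdeg o T2 v + outdeg o R v).
  exact: splitE.
(* At [z] the two bounds add up to the degree in [R], so both are attained and the degree of [z] is
   exactly [t]. *)
pose Bd (b : bool) v := if v == z then
    if b then t - outdeg o T1 z else degree nonloops z - t - outdeg o T2 z
  else uphalf (degree nonloops v) - if b then outdeg o T1 v else outdeg o T2 v.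
(* At most half of the edges at [z] leave it, and at least [m0] of these are in [T2]; [zhi] uses the
   [m] arcs in [T1] likewise. *)
have zlo : outdeg o T1 z + outdeg o R z <= t.
  by have := outE z; lia.
have zhi : t + (outdeg o T2 z + outdeg o R z) <= degree nonloops z.
  by have := outE z; lia.
have [|p|v|col colP] := @edge_two_colouring G Bd R z.
- by move=> e; rewrite !inE => /andP[_ /andP[_]].
- apply: (@crossing_le_weight o) => b v; rewrite /Bd.
  case: eqP => [->|_]; first by case: b; lia.
  by have := outd v; have := outE v; case: b; lia.
- have := degreeE o T1 v; have := degreeE o T2 v; rewrite in1 in2.
  rewrite /Bd; case: eqP => [->|_] /=; first by have := degE z; lia.
  by have := degE v; have := outd v; have := outE v; lia.
pose C b := [set e in R | col e == b].
have CE v : degree R v = degree (C true) v + degree (C false) v.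
  rewrite !degree_filter -big_split /=; apply: eq_bigr => e _.
  by case: (col e); rewrite /= ?mul0n ?mul1n ?addn0.
have T1R : [disjoint T1 & C true].
  rewrite -setI_eq0 -subset0; apply/subsetP => e; rewrite !inE.
  by case: (e \in T1); rewrite ?andbF.
have HE v : degree (T1 :|: C true) v = degree T1 v + degree (C true) v.
  rewrite /degree (sum_subsetD _ (subsetUl T1 (C true))); congr (_ + _).
  by rewrite setDUl setDv set0U (setDidPl _) // disjoint_sym.
exists (T1 :|: C true); split.
- rewrite subUset T1n; apply/subsetP => e; rewrite inE => /andP[+ _].
  by rewrite !inE => /andP[_ /andP[]].
- exact: tree_connected_sub (subsetUl _ _) tc1.
- apply: tree_connected_sub tc2; rewrite subsetD T2n /=.
  rewrite -setI_eq0 -subset0; apply/subsetP => e; rewrite !inE => /andP[e2].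
  by rewrite e2 (disjointFr T12 e2).
- have := colP true z; have := colP false z; rewrite /Bd eqxx -!/(C _).
  have := degreeE o T1 z; have := degreeE o T2 z; rewrite in1 in2 eqxx /=.
  by have := HE z; have := CE z; have := degE z; lia.
(* Away from [z], tree outdegrees cancel against the bounds and the indegrees [m] and [m0] remain:
   the first gives the upper bound, the second, via the complement, the lower one. *)
move=> v; have := colP true v; have := colP false v; rewrite /Bd -!/(C _).
have := degreeE o T1 v; have := degreeE o T2 v; rewrite in1 in2.
have := HE v; have := CE v; have := degE v.
case: eqP => [->|_] /=; first by lia.
by have := outE v; have := outd v; lia.
Qed.

(** * Distribution of the loops *)

Definition loops_at v : {set E} := [set e | endpoints e == (v, v)].

Lemma degree_loops (f : V -> {set E}) v : (forall v, f v \subset loops_at v) ->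
  degree (\bigcup_v f v) v = 2 * #|f v|.
Proof.
move=> fl; have fP w e : e \in f w -> endpoints e = (w, w).
  by move/(subsetP (fl w)); rewrite inE => /eqP.
rewrite /degree partition_disjoint_bigcup => [|x y xy]; last first.
  rewrite -setI_eq0 -subset0; apply/subsetP => e; rewrite inE => /andP[/fP ex /fP].
  by rewrite ex => -[xE _]; rewrite xE eqxx in xy.
rewrite (bigD1 v) //= [X in _ + X]big1 => [|w /negPf wv].
  rewrite addn0 mulnC -sum_nat_const; apply: eq_bigr => e /fP ->.
  by rewrite /= eqxx.
by rewrite big1 // => e /fP ->; rewrite /= wv.
Qed.

Lemma degree_setT v : degree setT v = degree nonloops v + 2 * #|loops_at v|.
Proof.
rewrite -(degree_loops v (fun v => subxx (loops_at v))) /degree.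
rewrite (sum_subsetD _ (subsetT nonloops)); congr (_ + _).
apply: eq_bigl => e; rewrite !inE andbT negbK.
apply/eqP/bigcupP => [E|[w _]]; last by rewrite inE => /eqP ->.
by exists (src e) => //; rewrite inE {2}E -surjective_pairing.
Qed.

Lemma add_loops H (n : V -> nat) : H \subset nonloops ->
    (forall v, n v <= #|loops_at v|) ->
  exists H', [/\ H \subset H', nonloops :\: H \subset ~: H'
    & forall v, degree H' v = degree H v + 2 * n v].
Proof.
move=> Hn nl.
have /fin_all_exists[f fP] v : exists A : {set E}, A \subset loops_at v /\ #|A| = n v.
  have /card_geqP[s [us ss sub]] := nl v.
  exists [set e in s]; split; last by rewrite cardsE (card_uniqP us).
  by apply/subsetP => e; rewrite inE => /sub.
have Ln e : e \in \bigcup_v f v -> e \notin nonloops.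
  case/bigcupP=> v _ /(subsetP (fP v).1); rewrite !inE => /eqP ->.
  by rewrite /= eqxx.
exists (H :|: \bigcup_v f v); split=> [||v]; first exact: subsetUl.
  apply/subsetP => e; rewrite in_setD in_setC in_setU negb_or => /andP[-> en] /=.
  by apply: contraL en => /Ln.
rewrite -(fP v).2 -(degree_loops v (fun v => (fP v).1)) /degree.
rewrite (sum_subsetD _ (subsetUl H _)); congr (_ + _); apply: eq_bigl => e.
rewrite !inE; case eH: (e \in H) => //=; apply/esym/negP => /Ln.
by rewrite (subsetP Hn _ eH).
Qed.

End Main.

Theorem theorem4p6 (m m0 : nat) (G : mgraph)
  (hm : 0 < m + m0)
  (hG : edge_connected (2 * m + 2 * m0) G) :
  (exists H : {set edge G}, good_factor m m0 H) /\
  (1 < #|vertex G| ->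
   forall (z : vertex G) (t : int), half_degree_range m m0 z t ->
   exists H : {set edge G}, good_factor m m0 H /\ Posz (degree H z) = t).
Proof.
rewrite -mulnDr in hG.
pose l v := #|@loops_at G v|; pose d v := degree (nonloops G) v.
have extend (H : {set edge G}) z n : H \subset nonloops G ->
    tree_connected m H -> tree_connected m0 (nonloops G :\: H) ->
    (forall v, (d v)./2 <= degree H v + m0 /\ degree H v <= uphalf (d v) + m) ->
    n <= l z -> half_degree_range m m0 z (Posz (degree H z + 2 * n)) ->
  exists2 H' : {set edge G}, good_factor m m0 H' & degree H' z = degree H z + 2 * n.
  move=> Hn tc tc0 Hd nz nzr.
  (* Half of the loops go to [H], rounded up when there is room above. Otherwise [H] is at its upper
     bound, which exceeds the lower one because [m + m0 > 0], so rounding down is safe. *)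
  pose r v := if v == z then n else
    if degree H v < uphalf (d v) + m then uphalf (l v) else (l v)./2.
  have [|H' [HH' HH'c degH']] := @add_loops G H r Hn.
    by move=> v; rewrite -/(l v) /r; case: eqP => [-> //|_]; case: ifP; lia.
  exists H'; last by rewrite degH' /r eqxx.
  split=> [||v]; [exact: tree_connected_sub tc|exact: tree_connected_sub tc0|].
  rewrite degH' /r; case: eqP => [-> //|_].
  rewrite /half_degree_range degree_setT -/(d v) -/(l v).
  by have [] := Hd v; case: leqP; lia.
have second : 1 < #|vertex G| ->
   forall (z : vertex G) (t : int), half_degree_range m m0 z t ->
   exists H : {set edge G}, good_factor m m0 H /\ Posz (degree H z) = t.
  move=> V1 z t tr.
  have dz := degree_nonloops_ge z hG V1.
  have [t' [n [tlo thi nl tE]]] : exists t' n, [/\ (d z)./2 <= t' + m0,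
      t' <= uphalf (d z) + m, n <= l z & t = Posz (t' + 2 * n)].
    case: tr; rewrite degree_setT -/(d z) -/(l z) => h1 h2; rewrite -/(d z) in dz.
    (* Round down the loops at [z] unless this would leave [t - 2 * a] above the loopless upper
       bound; [dz] keeps this difference nonnegative. *)
    pose a := if (t + (odd (l z))%:Z <= (uphalf (d z) + l z + m)%:Z)%R then (l z)./2 else uphalf (l z).
    exists (absz (t - (2 * a)%:Z)%R), a; rewrite /a; case: ifP; split; lia.
  have [H [Hn tc tc0 Hz Hd]] := loopless_factor hm hG V1 tlo thi.
  have [|H' good E] := extend H z n Hn tc tc0 Hd nl; first by rewrite Hz -tE.
  by exists H'; rewrite E Hz tE.
split=> //.
have [V1|V1] := ltnP 1 #|vertex G|.
  have [z _] : exists z : vertex G, z \in vertex G by apply/card_gt0P; apply: ltnW.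
  have [|H [good _]] := second V1 z (Posz (degree setT z)./2); last by exists H.
  by rewrite /half_degree_range; lia.
have one (x y : vertex G) : x = y by apply: (fintype_le1P V1).
have tree0 : spanning_tree (set0 : {set edge G}).
  split=> [x y|x p [p0 + _ _]]; first by rewrite (one x y) connect0.
  by case: p p0 => // -[e y] p _ /=; rewrite inE.
have tc n (F : {set edge G}) : tree_connected n F.
  by exists (fun=> set0); split=> // *; rewrite ?sub0set // -setI_eq0 set0I.
have n0 : nonloops G = set0.
  by apply/setP => e; rewrite !inE (one (endpoints e).1 (endpoints e).2) eqxx.
have d0 v : d v = 0 by rewrite /d n0 /degree big_set0.
have D0 v : degree (set0 : {set edge G}) v = 0 by rewrite /degree big_set0.
have [z|noV] := pickP (vertex G); last first.
  by exists set0; split=> // v; have := noV v.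
(* On a single vertex only loops count. An odd number of them is rounded up if [m > 0]; otherwise
   [m0 > 0] and rounding down is allowed. *)
have [||||||H good _] := extend set0 z ((l z + (m > 0)))./2 => //; last by exists H.
- exact: sub0set.
- by move=> v; rewrite d0 D0.
- by case: (m); lia.
by rewrite /half_degree_range degree_setT -/(d z) d0 D0 -/(l z); lia.
Qed.
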